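(* Let $n\ge4$ and $k\ge1$ be integers. Then \[ \gamma_{[k]R}(C_8\Box P_n)\le 8(n-2)\left\lceil\frac{k+4}{5}\right\rceil+16\left\lceil\frac{k+3-\left\lceil\frac{k+4}{5}\right\rceil}{3}\right\rceil . \]
   Context: For a graph $G$ and $v\in V(G)$, $N(v)$ is the open neighborhood and $N[v]=N(v)\cup\{v\}$. For an integer $k\ge1$, a function $f:V(G)\to\{0,1,\dots,k+1\}$ is a $[k]$-Roman dominating function if for every vertex $v$ with $f(v)<k$ we have $\sum_{u\in N[v]}f(u)\ge k+|\{u\in N(v): f(u)>0\}|$. The weight of $f$ is $\sum_{v}f(v)$, and $\gamma_{[k]R}(G)$ is the minimum weight of a $[k]$-Roman dominating function on $G$. $C_m\Box P_n$ is the Cartesian product of the cycle $C_m$ (vertices $0,\dots,m-1$ mod $m$) and the path $P_n$ (vertices $0,\dots,n-1$): $(i,j)\sim(i',j')$ iff ($i=i'$ and $|j-j'|=1$) or ($j=j'$ and $i'\equiv i\pm1 \pmod m$). *)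

(* Defs.v *)
From HB Require Import structures.
From mathcomp Require Import all_boot all_order all_algebra.

Set Implicit Arguments.
Unset Strict Implicit.
Unset Printing Implicit Defensive.

Section RomanDomination.

(* A graph is given by its adjacency relation [e] on a finite vertex type. *)
Variables (V : finType) (e : rel V).

Definition open_nbhd (v : V) : {set V} := [set u | e v u].

Definition closed_nbhd (v : V) : {set V} := v |: open_nbhd v.

Variable k : nat.

(* The ordinals below [k.+2] are the labels 0, 1, ..., k+1. *)
Definition labelling := {ffun V -> 'I_k.+2}.

Definition roman_dominating (f : labelling) : bool :=
  [forall v : V, (f v < k) ==>
     (k + #|[set u in open_nbhd v | 0 < f u]| <= \sum_(u in closed_nbhd v) f u)].

Definition weight (f : labelling) : nat := \sum_(v : V) f v.

Definition const_max : labelling := [ffun=> ord_max].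

(* The constant labelling k+1 is always dominating ([const_max_dominating]),
   so this is a minimum over a nonempty set; see [roman_numberP]. *)
Definition roman_number : nat :=
  weight [arg min_(f < const_max | roman_dominating f) weight f].

Lemma const_max_dominating : roman_dominating const_max.
Proof. by apply/forallP => v; rewrite ffunE /= ltnNge leqnSn. Qed.

Lemma roman_numberP :
  (exists2 f, roman_dominating f & weight f = roman_number) /\
  (forall f, roman_dominating f -> roman_number <= weight f).
Proof.
rewrite /roman_number; case: arg_minnP => [|f fP fmin].
  exact: const_max_dominating.
by split=> //; exists f.
Qed.

End RomanDomination.

(* The second disjunct says j = i - 1 modulo m.  For m >= 3 this is the usual
   simple cycle; for m = 1 the relation has a loop. *)
Definition cycle_adj (m : nat) : rel 'I_m :=
  fun i j => (j == i.+1 %[mod m]) || (j.+1 == i %[mod m]).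

Definition path_adj (n : nat) : rel 'I_n :=
  fun i j => (j == i.+1 :> nat) || (i == j.+1 :> nat).

Definition cartesian_product (S T : finType) (e : rel S) (e' : rel T) :
    rel (S * T) :=
  fun u v => ((u.1 == v.1) && e' u.2 v.2) || ((u.2 == v.2) && e u.1 v.1).

Definition cycle_box_path (m n : nat) : rel ('I_m * 'I_n) :=
  cartesian_product (@cycle_adj m) (@path_adj n).

Lemma cycle_box_path_sym m n : symmetric (@cycle_box_path m n).
Proof.
move=> [i j] [i' j']; rewrite /cycle_box_path /cartesian_product /=.
rewrite /cycle_adj /path_adj (eq_sym i) (eq_sym j) (orbC (j' == _ :> nat)).
by rewrite (orbC (i' == _ %[mod m])) (eq_sym (i'.+1 %% m)) (eq_sym (i' %% m)).
Qed.

Lemma cycle_box_path_irrefl m n : 1 < m -> irreflexive (@cycle_box_path m n).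
Proof.
move=> m1 [i j]; rewrite /cycle_box_path /cartesian_product /=.
rewrite /cycle_adj /path_adj !eqxx /= !(ltn_eqF (ltnSn j)) /=.
by rewrite (eq_sym (i.+1 %% m)) orbb -addn1 -{1}[X in X == _ %[mod m]]addn0 eqn_modDl mod0n modn_small.
Qed.

(* Main.v *)
(* Label every vertex of the two end columns with b = ceil((k+3-a)/3) and every
   other vertex with a = ceil((k+4)/5).  Subtracting 1 from every neighbour
   turns the domination condition at v into f(v) + sum (f(u) - 1) >= k over the
   neighbours u: an end vertex needs 3b + a >= k + 3, and an inner one
   5a >= k + 4 as soon as a <= b.  The inequality a <= b fails only for k = 2,
   where a = 2 >= k imposes no condition on the inner vertices. *)
Require Import Defs.
From mathcomp Require Import all_boot all_order all_algebra.
From mathcomp Require Import zify.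

Set Implicit Arguments.
Unset Strict Implicit.
Unset Printing Implicit Defensive.

Import Order.TTheory GRing.Theory Num.Theory.

(** With all labels positive, the count of positive neighbours is the degree, so each neighbour
    absorbs a 1. The remaining terms are nonnegative: any duplicate-free list of some neighbours
    gives a lower bound, and no neighbourhood has to be computed exactly. *)
Lemma positive_roman_dominating (V : finType) (e : rel V) (k : nat)
    (f : labelling V k) :
  irreflexive e -> (forall v, 0 < f v) ->
  (forall v, f v < k -> exists2 s : seq V,
     uniq s && all (e v) s & k <= f v + \sum_(u <- s) (f u).-1) ->
  roman_dominating e f.
Proof.
move=> irr_e f_gt0 f_dom; apply/forallP => v; apply/implyP => /f_dom[s].
case/andP=> s_uniq /allP s_nbhd k_le.
rewrite big_setU1 ?inE ?irr_e //=.
have -> : [set u in open_nbhd e v | 0 < f u] = open_nbhd e v.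
  by apply/setP => u; rewrite inE f_gt0 andbT.
have -> : \sum_(u in open_nbhd e v) f u =
    \sum_(u in open_nbhd e v) (f u).-1 + #|open_nbhd e v|.
  rewrite -sum1_card -big_split /=; apply: eq_bigr => u _.
  by rewrite addn1 prednK.
rewrite addnA leq_add2r (leq_trans k_le) // leq_add2l.
rewrite big_uniq // big_mkcond [leqRHS]big_mkcond leq_sum // => u _ /=.
by case: ifP => // /s_nbhd euv; rewrite inE euv.
Qed.

Lemma cycle_adj_ordS m (i : 'I_m) : cycle_adj i (ordS i).
Proof. by rewrite /cycle_adj /= modn_mod eqxx. Qed.

Lemma cycle_adj_ord_pred m (i : 'I_m) : cycle_adj i (ord_pred i).
Proof.
have := cycle_adj_ordS (ord_pred i).
by rewrite ord_predK /cycle_adj orbC (eq_sym (val i %% m)) (eq_sym (i.+1 %% m)).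
Qed.

(** Modulo [m] the two differ by [m - 2], which lies strictly between 0 and [m]. *)
Lemma ordS_neq_ord_pred m (i : 'I_m) : 2 < m -> ordS i != ord_pred i.
Proof.
move=> m_gt2; apply/eqP => /(congr1 val) /= E.
have i_lt := ltn_ord i.
have {}E : i.+1 == (i + m).-1 %[mod m] by rewrite E.
rewrite eq_sym eqn_mod_dvd in E; last lia.
have : (i + m).-1 - i.+1 = m - 2 by lia.
move=> E2; rewrite E2 in E.
by have := dvdn_leq _ E; lia.
Qed.

Section EndColumns.

Variables (m p k a b : nat).

Definition end_column (j : nat) : bool := (j == 0) || (j == p.+1).

(** [inord] falls back to 0 above [k.+1]; the bounds [a_le] and [b_le] rule this out. *)
Definition end_column_labelling : labelling ('I_m * 'I_p.+2)%type k :=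
  [ffun v : 'I_m * 'I_p.+2 => inord (if end_column v.2 then b else a)].

Hypotheses (a_le : a <= k.+1) (b_le : b <= k.+1).

Lemma end_column_labellingE v :
  end_column_labelling v = (if end_column v.2 then b else a) :> nat.
Proof. by rewrite ffunE inordK //; case: ifP. Qed.

Lemma weight_end_column_labelling :
  weight end_column_labelling = m * p * a + m.*2 * b.
Proof.
rewrite /weight; under eq_bigr do rewrite end_column_labellingE.
rewrite -(pair_big predT predT
  (fun (_ : 'I_m) (j : 'I_p.+2) => if end_column j then b else a)) /=.
rewrite sum_nat_const card_ord big_ord_recl big_ord_recr /=.
rewrite /end_column /= /bump /= eqxx.
under eq_bigr => j _ do rewrite /= eqSS (ltn_eqF (ltn_ord j)).
by rewrite sum_nat_const card_ord; lia.
Qed.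

Lemma end_column_labelling_dominating :
  2 < m -> 0 < p -> 0 < a -> 0 < b ->
  k + 3 <= 3 * b + a -> (k <= a) || (k + 4 <= 5 * a) && (a <= b) ->
  roman_dominating (@cycle_box_path m p.+2) end_column_labelling.
Proof.
move=> m_gt2 p_gt0 a_gt0 b_gt0 end_dom inner_dom.
apply: positive_roman_dominating.
- by apply: cycle_box_path_irrefl; lia.
- by move=> v; rewrite end_column_labellingE; case: ifP.
move=> [i j]; rewrite end_column_labellingE /= => lt_k.
have neqSP := ordS_neq_ord_pred i m_gt2.
have adjS : cycle_box_path (i, j) (ordS i, j).
  by rewrite /cycle_box_path /cartesian_product /= eqxx cycle_adj_ordS orbT.
have adjP : cycle_box_path (i, j) (ord_pred i, j).
  by rewrite /cycle_box_path /cartesian_product /= eqxx cycle_adj_ord_pred orbT.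
have adjV (j' : 'I_p.+2) : path_adj j j' -> cycle_box_path (i, j) (i, j').
  by rewrite /cycle_box_path /cartesian_product /= eqxx => ->.
have j_lt := ltn_ord j.
have vneq (i' : 'I_m) (j' : 'I_p.+2) : path_adj j j' -> (i', j) != (i, j').
  by rewrite /path_adj => adj; apply/eqP => -[_ jE]; rewrite jE in adj; lia.
case: ifP lt_k => [j_end b_lt | j_inner a_lt].
(* The one neighbour outside the end column; its column is inner because [0 < p]. The bound becomes
   [b + 2(b - 1) + (a - 1) >= k]. *)
- pose j' : 'I_p.+2 := inord (if j == 0 :> nat then 1 else p).
  have j'E : j' = (if j == 0 :> nat then 1 else p) :> nat.
    by rewrite inordK //; case: eqP; lia.
  have jj' : path_adj j j'.
    by rewrite /path_adj j'E; move: j_end; rewrite /end_column; case: eqP; lia.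
  have j'_inner : end_column j' = false.
    by rewrite /end_column j'E; case: ifP; lia.
  exists [:: (ordS i, j); (ord_pred i, j); (i, j')].
    rewrite /= !inE adjS adjP adjV // !negb_or !(negbTE (vneq _ _ jj')).
    by rewrite xpair_eqE eqxx andbT neqSP.
  rewrite !big_cons big_nil !end_column_labellingE /= j_end j'_inner; lia.
(* Here [a < k], which excludes the first alternative. *)
have {inner_dom} /andP[inner_dom a_le_b] : (k + 4 <= 5 * a) && (a <= b) by lia.
have j_gt0 : 0 < j by move: j_inner; rewrite /end_column; lia.
have j_ltp : j < p.+1 by move: j_inner; rewrite /end_column; lia.
pose jl : 'I_p.+2 := inord j.-1; pose jr : 'I_p.+2 := inord j.+1.
have jlE : jl = j.-1 :> nat by rewrite inordK //; lia.
have jrE : jr = j.+1 :> nat by rewrite inordK //; lia.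
have jjl : path_adj j jl by rewrite /path_adj jlE; lia.
have jjr : path_adj j jr by rewrite /path_adj jrE; lia.
exists [:: (ordS i, j); (ord_pred i, j); (i, jl); (i, jr)].
  rewrite /= !inE adjS adjP !adjV // !negb_or !(negbTE (vneq _ _ jjl)).
  rewrite !(negbTE (vneq _ _ jjr)) !xpair_eqE !eqxx andbT neqSP /=.
  by rewrite -(inj_eq val_inj) /= jlE jrE; lia.
rewrite !big_cons big_nil !end_column_labellingE /= j_inner.
(* Either column beside [j] may be an end column; since [a <= b] its label is at least [a] anyway,
   and [a + 4(a - 1) >= k]. *)
by do 2![case: ifP => _]; lia.
Qed.

End EndColumns.

Local Open Scope ring_scope.

(** Writing [p + d = q(d + 1) + r] with [r <= d] gives [(q - 1)(d + 1) < p <= q(d + 1)]. *)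
Lemma ceil_nat_div (p d : nat) :
  Num.ceil (p%:Q / d.+1%:Q) = ((p + d) %/ d.+1)%N :> int.
Proof.
apply: ceil_def; have d_gt0 : (0 : rat) < d.+1%:Q by rewrite ltr0n.
rewrite ltr_pdivlMr // ler_pdivrMr // -!intrM ltr_int ler_int.
have := divn_eq (p + d) d.+1; have := @ltn_pmod (p + d) d.+1 isT.
by set q := (_ %/ _)%N; set r := (_ %% _)%N; nia.
Qed.

Theorem theorem20 (n k : nat) (n_ge4 : (4 <= n)%N) (k_ge1 : (1 <= k)%N) :
  ((roman_number (@cycle_box_path 8 n) k)%:Z <=
     8%:Z * (n%:Z - 2%:Z) * Num.ceil ((k%:Q + 4) / 5)
     + 16%:Z * Num.ceil ((k%:Q + 3 - (Num.ceil ((k%:Q + 4) / 5))%:~R) / 3))%R.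
Proof.
have -> : Num.ceil ((k%:Q + 4) / 5) = ((k + 8) %/ 5)%N.
  by have := ceil_nat_div (k + 4) 4; rewrite PoszD intrD -addnA.
set a := ((k + 8) %/ 5)%N; have a_le : (a <= k)%N by rewrite /a; lia.
have -> : Num.ceil ((k%:Q + 3 - a%:~R) / 3) = ((k + 5 - a) %/ 3)%N.
  have := ceil_nat_div (k + 3 - a) 2.
  (* Since [a <= k], the truncated difference [k + 3 - a] is the true one. *)
  rewrite -subzn; last lia.
  rewrite intrB PoszD intrD => ->.
  by congr (Posz (_ %/ _)); lia.
set b := ((k + 5 - a) %/ 3)%N.
(* Now [p = n - 2] counts the inner columns, and the weight [8pa + 16b] is exactly the right-hand
   side. *)
case: n n_ge4 => [|[|p]] // p_ge2.
have dom : roman_dominating (@cycle_box_path 8 p.+2)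
    (end_column_labelling 8 p k a b).
  by apply: end_column_labelling_dominating; rewrite /b /a; lia.
have := (roman_numberP (@cycle_box_path 8 p.+2) k).2 _ dom.
rewrite weight_end_column_labelling; [|lia|rewrite /b; lia].
by move: (roman_number _ _) => w; nia.
Qed.
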